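(* Up to isomorphism, the only minimally $\gamma_g$-imperfect triangle-free graphs are the path $P_5$, the cycle $C_5$, and the six graphs $F_1,\dots,F_6$ of the family $\mathcal{F}$.
   Context: Graphs are finite, simple, undirected, with at least one vertex, not necessarily connected. $P_n$ and $C_n$ are the path and the cycle on $n$ vertices. $\gamma(G)$ is the domination number of $G$. Domination game on $G$: Dominator and Staller alternately select vertices; each selected vertex must dominate (i.e. contain in its closed neighborhood) at least one vertex not dominated by the previously selected vertices. The game ends when no legal move exists. Dominator wants to minimize and Staller to maximize the total number of moves. $\gamma_g(G)$ is the number of moves under optimal play when Dominator starts. $G$ is $\gamma_g$-perfect if every induced subgraph $F$ of $G$ satisfies $\gamma_g(F)=\gamma(F)$. $G$ is minimally $\gamma_g$-imperfect if each of its proper induced subgraphs is $\gamma_g$-perfect but $\gamma(G)<\gamma_g(G)$. The family $\mathcal{F}=\{F_1,\dots,F_6\}$ consists of the following bipartite graphs on six vertices: $F_1=2P_3$ (disjoint union of two copies of $P_3$); $F_2$ is the tree consisting of two adjacent vertices, each having two further leaf neighbors; $F_3$ is obtained from a 4-cycle by attaching one pendant vertex to each of two adjacent vertices of the cycle; $F_4$ is obtained from $K_{2,3}$ by attaching one pendant vertex to a vertex of degree $2$; $F_5$ is $K_{3,3}$ minus an edge; $F_6=K_{3,3}$. *)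

(* Defs.v *)
From mathcomp Require Import all_boot.

Set Implicit Arguments.
Unset Strict Implicit.
Unset Printing Implicit Defensive.

Record sgraph := SGraph {
  vertex :> finType;
  adj : rel vertex;
  adj_sym : symmetric adj;
  adj_irr : irreflexive adj
}.

Definition isomorphic (G H : sgraph) : Prop :=
  exists2 f : G -> H, bijective f & {mono f : x y / adj x y}.

Definition triangle_free (G : sgraph) : Prop :=
  forall x y z : G, ~~ [&& adj x y, adj y z & adj x z].

Section Induced.
Variables (G : sgraph) (A : {set G}).
Definition induced_adj : rel {x : G | x \in A} :=
  fun x y => adj (val x) (val y).
Lemma induced_adj_sym : symmetric induced_adj.
Proof. by move=> x y; apply: adj_sym. Qed.
Lemma induced_adj_irr : irreflexive induced_adj.
Proof. by move=> x; apply: adj_irr. Qed.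
Definition induced : sgraph := SGraph induced_adj_sym induced_adj_irr.
End Induced.

Section Domination.
Variable G : sgraph.
Implicit Types (v : G) (S : {set G}).

Definition cl_nbh v : {set G} := [set u | (u == v) || adj v u].

Definition dominated S : {set G} := \bigcup_(v in S) cl_nbh v.

Definition dominating S : bool := dominated S == [set: G].

Definition domination_number : nat :=
  #|[arg min_(S < [set: G] | dominating S) #|S| ]|.

(* S is the set of the vertices selected so far. *)
Definition legal S v : bool := ~~ (cl_nbh v \subset dominated S).

(* The number of further moves under optimal play from the position S, where
   [dom] tells whether Dominator is to move. The recursion is bounded by
   [fuel]; as every legal move dominates a new vertex, [#|G|] is always
   enough (see [game_length_fuel]). *)
Fixpoint game_length (fuel : nat) (dom : bool) S : nat :=
  if fuel is k.+1 then
    if [pick v | legal S v] is Some v0 then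
      let len v := game_length k (~~ dom) (v |: S) in
      (if dom then len [arg min_(v < v0 | legal S v) len v]
       else len [arg max_(v > v0 | legal S v) len v]).+1
    else 0
  else 0.

Definition game_domination_number : nat := game_length #|G| true set0.

Lemma dominatedU1 v S : dominated (v |: S) = cl_nbh v :|: dominated S.
Proof. by rewrite /dominated bigcup_setU big_set1. Qed.

Lemma game_length_fuel k l dom S :
  #|~: dominated S| <= k -> #|~: dominated S| <= l ->
  game_length k dom S = game_length l dom S.
Proof.
have legal_pos v T : legal T v -> 0 < #|~: dominated T|.
  move=> Tv; rewrite card_gt0; apply: contraNneq Tv => T0.
  by rewrite -[dominated T]setCK T0 setC0 subsetT.
have legal_le v n T : legal T v -> #|~: dominated T| <= n.+1 ->
    #|~: dominated (v |: T)| <= n.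
  move=> Tv leTn; rewrite -ltnS; apply: leq_trans leTn; apply: proper_card.
  rewrite properE !setCS dominatedU1 subsetUr /=.
  by apply: contra Tv; apply: subset_trans; apply: subsetUl.
have done d T n : #|~: dominated T| <= 0 -> game_length n d T = 0.
  case: n => //= n; rewrite leqNgt => T0; case: pickP => // v Tv.
  by rewrite (legal_pos v) in T0.
elim: k l dom S => [|k IH] l dom S lek lel; first by rewrite !done.
case: l lel => [|l] lel; first by rewrite !done.
have E v : legal S v ->
    game_length k (~~ dom) (v |: S) = game_length l (~~ dom) (v |: S).
  by move=> Sv; apply: IH; apply: legal_le.
rewrite /=; case: pickP => // v0 Sv0; congr _.+1; case: dom E => /= E.
- case: arg_minnP => // u Su minu; case: arg_minnP => // w Sw minw.
  by apply/eqP; rewrite eqn_leq -(E w) // minu //= (E w) // (E u) // minw.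
- case: arg_maxnP => // u Su maxu; case: arg_maxnP => // w Sw maxw.
  apply/eqP; rewrite eqn_leq -(E w) //; apply/andP; split; last exact: maxu.
  by rewrite (E u) // (E w) //; apply: maxw.
Qed.

End Domination.

Definition gg_perfect (G : sgraph) : Prop :=
  forall A : {set G}, A != set0 ->
    game_domination_number (induced A) = domination_number (induced A).

Definition minimally_gg_imperfect (G : sgraph) : Prop :=
  (forall A : {set G}, A != set0 -> A \proper [set: G] ->
     gg_perfect (induced A)) /\
  domination_number G < game_domination_number G.

Section EdgeGraph.
Variables (n : nat) (E : seq (nat * nat)).
Definition edge_adj : rel 'I_n := fun i j =>
  (i != j) && (((val i, val j) \in E) || ((val j, val i) \in E)).
Lemma edge_adj_sym : symmetric edge_adj.
Proof. by move=> i j; rewrite /edge_adj eq_sym orbC. Qed.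
Lemma edge_adj_irr : irreflexive edge_adj.
Proof. by move=> i; rewrite /edge_adj eqxx. Qed.
Definition edge_graph : sgraph := SGraph edge_adj_sym edge_adj_irr.
End EdgeGraph.

Definition path_graph (n : nat) : sgraph :=
  edge_graph n [seq (i, i.+1) | i <- iota 0 n.-1].

(* The n-cycle for [3 <= n]. *)
Definition cycle_graph (n : nat) : sgraph :=
  edge_graph n [seq (i, i.+1 %% n) | i <- iota 0 n].

(* The edges of the complete bipartite graph with parts
   {0, ..., m - 1} and {m, ..., m + n - 1}. *)
Definition biclique_edges (m n : nat) : seq (nat * nat) :=
  [seq (i, j) | i <- iota 0 m, j <- iota m n].

Definition F1 : sgraph := edge_graph 6 [:: (0, 1); (1, 2); (3, 4); (4, 5)].

Definition F2 : sgraph :=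
  edge_graph 6 [:: (0, 1); (0, 2); (0, 3); (1, 4); (1, 5)].

Definition F3 : sgraph :=
  edge_graph 6 [:: (0, 1); (1, 2); (2, 3); (3, 0); (0, 4); (1, 5)].

Definition F4 : sgraph := edge_graph 6 ((2, 5) :: biclique_edges 2 3).

Definition F5 : sgraph := edge_graph 6 (rem (0, 3) (biclique_edges 3 3)).

Definition F6 : sgraph := edge_graph 6 (biclique_edges 3 3).

(* Main.v *)
Require Import Defs.
From mathcomp Require Import all_boot.

Set Implicit Arguments.
Unset Strict Implicit.
Unset Printing Implicit Defensive.

(** Suppose that the triangle-free graph G contains none of the eight graphs, and
    let v be a vertex of maximum degree. The vertices outside N[v] then split
    into blocks such that every closed neighbourhood meets at most one block and
    contains the block it meets: a violation is a P3 with two vertices outside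
    N[v], and according to its distance to v it yields 2P3, P5 or C5, or one of
    F2, ..., F6. Hence, once Dominator has played v, each further move
    disposes of exactly one block, whoever plays it. Finally, a minimum dominating
    set T has a vertex that is not needed to dominate the blocks, so that the
    game lasts at most |T| moves.

    Conversely, on each of the eight graphs two vertices dominate, but Staller
    can answer every first move without ending the game. *)

(** * The domination number and the length of the game *)

Section Game.
Variable G : sgraph.
Implicit Types (a b u v w x y z : G) (S T : {set G}).

Lemma cl_nbhE v u : (u \in cl_nbh v) = (u == v) || adj v u.
Proof. by rewrite inE. Qed.

Lemma cl_nbh_refl v : v \in cl_nbh v.
Proof. by rewrite cl_nbhE eqxx. Qed.

Lemma dominated1 v : dominated [set v] = cl_nbh v.
Proof. exact: big_set1. Qed.

Lemma legalP S v :
  reflect (exists2 u, u \in cl_nbh v & u \notin dominated S) (legal S v).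
Proof. exact: subsetPn. Qed.

Lemma no_legal_dominating S : legal S =1 xpred0 -> dominating S.
Proof.
move=> noS; rewrite /dominating eqEsubset subsetT; apply/subsetP => x _.
by apply: contraFT (noS x) => xS; apply/legalP; exists x; rewrite ?cl_nbh_refl.
Qed.

Lemma legal_decr S v :
  legal S v -> #|~: dominated (v |: S)| < #|~: dominated S|.
Proof.
case/legalP=> u uv uS; apply: proper_card; apply/properP.
rewrite dominatedU1 setCS subsetUr; split=> //.
by exists u; rewrite !inE ?uS // -cl_nbhE uv.
Qed.

Lemma dominating_setT : dominating [set: G].
Proof.
apply: no_legal_dominating => v; apply: negbTE; apply/negP=> /legalP[u _ /bigcupP[]].
by exists u; rewrite ?cl_nbh_refl.
Qed.

Lemma domination_number_le S : dominating S -> domination_number G <= #|S|.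
Proof.
rewrite /domination_number; case: arg_minnP => [|T _ minT]; last exact: minT.
exact: dominating_setT.
Qed.

Lemma domination_number_attained :
  exists2 T : {set G}, dominating T & #|T| = domination_number G.
Proof.
rewrite /domination_number; case: arg_minnP => [|T domT _]; last by exists T.
exact: dominating_setT.
Qed.

(** However the players move, the vertices played until no move is legal complete [S] to a
    dominating set. *)
Lemma dominating_extension k dom S : #|~: dominated S| <= k ->
  exists2 T : {set G}, dominating T & #|T| <= #|S| + game_length k dom S.
Proof.
elim: k dom S => [|k IH] dom S leSk /=.
  exists S; last by rewrite addn0.
  move: leSk; rewrite leqn0 cards_eq0 => /eqP S0.
  by rewrite /dominating -[dominated S]setCK S0 setC0.
case: pickP => [v0 Sv0|/no_legal_dominating ?]; last by exists S; rewrite ?addn0.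
have step v : legal S v -> exists2 T : {set G}, dominating T &
    #|T| <= #|S| + (game_length k (~~ dom) (v |: S)).+1.
  move=> Sv; case: (IH (~~ dom) (v |: S)).
    by rewrite -ltnS (leq_trans (legal_decr Sv)).
  move=> T domT leT; exists T => //; apply: leq_trans leT _.
  by rewrite addnS -addSn leq_add2r cardsU1 -add1n leq_add2r leq_b1.
case: dom step {IH} => /= step.
  by case: arg_minnP => // v /step.
by case: arg_maxnP => // v /step.
Qed.

Lemma domination_number_le_game : domination_number G <= game_domination_number G.
Proof.
have [|T domT leT] := @dominating_extension #|G| true set0; first exact: max_card.
by rewrite cards0 in leT; apply: leq_trans (domination_number_le domT) leT.
Qed.

(* Staller's reply [u] to [v] is legal because of [w] and leaves [z] undominated. *)
Definition two_move_gap : Prop :=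
  (exists a b, forall x, (x \in cl_nbh a) || (x \in cl_nbh b)) /\
  (forall v, exists u w z, [&& w \in cl_nbh u, w \notin cl_nbh v,
     z \notin cl_nbh u & z \notin cl_nbh v]).

Lemma game_length_gt0 k dom S x :
  x \notin dominated S -> 0 < game_length k.+1 dom S.
Proof.
move=> xS /=; case: pickP => // /(_ x) /negbT/negP[].
by apply/legalP; exists x; rewrite ?cl_nbh_refl.
Qed.

(** Two vertices dominate, whereas after any first move Staller's reply leaves [z] undominated,
    which forces a third move. *)
Lemma two_move_gap_imperfect :
  0 < #|G| -> two_move_gap -> domination_number G < game_domination_number G.
Proof.
move=> /card_gt0P[v0 _] [[a [b domab]] reply].
apply: (@leq_ltn_trans 2).
  apply: (@leq_trans #|[set a; b]|); last by rewrite cards2; case: (_ == _).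
  apply: domination_number_le; rewrite /dominating /dominated.
  by rewrite bigcup_setU !big_set1 eqEsubset subsetT; apply/subsetP => x _; rewrite inE.
have [u [w [z /and4P[wu wv0 zu zv0]]]] := reply v0.
(* [v0], [w], [z] are distinct, so the fuel [#|G|] can be unfolded for three moves. *)
have: 2 < #|G|.
  have /subset_leq_card: [set v0; w; z] \subset [set: G] by apply: subsetT.
  rewrite cardsT; apply: leq_trans; rewrite setUC cardsU1 !inE negb_or cards2.
  have -> : v0 != w by apply: contraNneq wv0 => <-; apply: cl_nbh_refl.
  have -> : z != v0 by apply: contraNneq zv0 => ->; apply: cl_nbh_refl.
  by have -> : z != w by apply: contraNneq zu => ->.
rewrite /game_domination_number; case: #|G| => [|[|[|k]]] // _.
have ge2 v : 1 < game_length k.+2 false [set v].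
  have [u' [w' [z' /and4P[w'u w'v z'u z'v]]]] := reply v.
  have lu' : legal [set v] u' by apply/legalP; exists w'; rewrite ?dominated1.
  have pos : 0 < game_length k.+1 true (u' |: [set v]).
    apply: (@game_length_gt0 _ _ _ z').
    by rewrite dominatedU1 dominated1 inE negb_or z'u.
  move: k.+1 pos => m pos /=; case: pickP => [x xv|/(_ u')]; last by rewrite lu'.
  by rewrite ltnS; case: arg_maxnP => // y _ /(_ _ lu'); apply: leq_trans.
move: k.+2 ge2 => m ge2 /=; case: pickP => [x x0|/(_ v0)/negbT/negP[]]; last first.
  by apply/legalP; exists v0; rewrite ?cl_nbh_refl // /dominated big_set0 inE.
by rewrite ltnS; case: arg_minnP => // y _ _; have := ge2 y; rewrite setU0.
Qed.

(** * The game after an opening move that leaves blocks *)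

Section Blocks.
Variable v : G.
Local Notation U := (~: cl_nbh v).
Hypothesis blocks : forall x y u u', u \in U -> u' \in U ->
  u \in cl_nbh x -> u \in cl_nbh y -> u' \in cl_nbh x -> u' \in cl_nbh y.

(* Each move disposes of a whole block of [U], hence of every vertex of [T]
   that is still legal because of that block. *)
Lemma game_length_blocks T k dom S :
  U \subset dominated T -> v \in S ->
  game_length k dom S <= #|[set t in T | legal S t]|.
Proof.
move=> UT; elim: k dom S => [|k IH] dom S vS //=.
case: pickP => // v0 Sv0.
have step u : legal S u ->
    (game_length k (~~ dom) (u |: S)).+1 <= #|[set t in T | legal S t]|.
  move=> Su; apply: leq_ltn_trans (IH _ _ _) _; first by rewrite inE vS orbT.
  have [w wu wS] := legalP _ _ Su.
  have inU x : x \notin dominated S -> x \in U.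
    by move=> xS; rewrite inE; apply: contra xS => xv; apply/bigcupP; exists v.
  have /bigcupP[t tT wt] := subsetP UT _ (inU _ wS).
  apply: proper_card; apply/properP; split.
    apply/subsetP => x; rewrite !inE => /andP[-> /legalP[y yx]].
    rewrite dominatedU1 inE negb_or => /andP[_ yS].
    by apply/legalP; exists y.
  exists t; first by rewrite inE tT; apply/legalP; exists w.
  rewrite inE tT; apply/legalP=> -[y yt]; rewrite dominatedU1 inE negb_or.
  by case/andP=> /negP yu yS; apply: yu; apply: (blocks (inU _ wS) (inU _ yS) wt).
by case: dom step {IH} => /= step; [case: arg_minnP | case: arg_maxnP] => // u /step.
Qed.

Lemma game_domination_number_blocks T :
  U \subset dominated T -> game_domination_number G <= #|T|.+1.
Proof.
move=> UT; rewrite /game_domination_number.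
case: #|G| => [|k] //=; case: pickP => // v0 lv0.
have lv : legal set0 v.
  by apply/legalP; exists v; rewrite ?cl_nbh_refl // /dominated big_set0 inE.
rewrite ltnS; case: arg_minnP => // x _ /(_ v lv) /leq_trans; apply.
rewrite setU0; apply: leq_trans (game_length_blocks _ _ UT (set11 v)) _.
by apply: subset_leq_card; apply/subsetP => t; rewrite inE => /andP[].
Qed.

End Blocks.
End Game.

(** * Induced embeddings and concrete graphs *)

Implicit Types G H K : sgraph.

Definition embeds (H G : sgraph) : Prop :=
  exists2 f : H -> G, injective f & {mono f : x y / adj x y}.

Lemma embeds_trans K H G : embeds K H -> embeds H G -> embeds K G.
Proof.
move=> [f fI fM] [g gI gM]; exists (g \o f); first exact: inj_comp.
by move=> x y /=; rewrite gM fM.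
Qed.

Lemma embeds_induced G (A : {set G}) : embeds (induced A) G.
Proof. by exists val; first exact: val_inj. Qed.

Lemma isomorphic_embeds G H : isomorphic G H -> embeds G H.
Proof. by case=> f fB fM; exists f => //; apply: bij_inj. Qed.

Lemma isomorphic_sym G H : isomorphic G H -> isomorphic H G.
Proof.
case=> f [g fK gK] fM; exists g; first by exists f.
by move=> x y; rewrite -fM !gK.
Qed.

Lemma isomorphic_trans G H K : isomorphic G H -> isomorphic H K -> isomorphic G K.
Proof.
move=> [f fB fM] [g gB gM]; exists (g \o f); first exact: bij_comp.
by move=> x y /=; rewrite gM fM.
Qed.

Lemma embeds_card H G : embeds H G -> #|H| <= #|G|.
Proof. by case=> f fI _; apply: leq_card fI. Qed.

Lemma embeds_triangle_free H G : embeds H G -> triangle_free G -> triangle_free H.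
Proof. by case=> f _ fM tG x y z; rewrite -!fM tG. Qed.

Lemma isomorphic_two_move_gap G H : isomorphic G H -> two_move_gap G -> two_move_gap H.
Proof.
case=> f fB fM [[a [b dom]] reply]; have fI := bij_inj fB.
have fC x y : (f x \in cl_nbh (f y)) = (x \in cl_nbh y).
  by rewrite !cl_nbhE fM (inj_eq fI).
have [g fK gK] := fB; split.
  by exists (f a), (f b) => x; rewrite -(gK x) !fC.
move=> v; have [u [w [z wz]]] := reply (g v).
by exists (f u), (f w), (f z); rewrite -(gK v) !fC.
Qed.

Lemma isomorphic_image H G (f : H -> G) : injective f ->
  {mono f : x y / adj x y} -> isomorphic H (induced (f @: [set: H])).
Proof.
move=> fI fM; have fA x : f x \in f @: [set: H] by apply: imset_f.
exists (fun x => Sub (f x) (fA x) : induced _) => [|x y]; last exact: fM.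
apply: inj_card_bij => [x y /(congr1 val) /= /fI //|].
by rewrite card_sig card_imset // cardsT.
Qed.

Lemma isomorphic_induced_setT G : isomorphic G (induced [set: G]).
Proof.
exists (fun x => Sub x (in_setT x) : induced _) => //.
by apply: inj_card_bij => [x y /(congr1 val)|] //; rewrite card_sig cardsT.
Qed.

Section EdgeGraphs.
Variables (n : nat) (E : seq (nat * nat)).

Definition edgeb (i j : nat) : bool :=
  (i != j) && (((i, j) \in E) || ((j, i) \in E)).

Lemma ord_all (P : pred nat) : all P (iota 0 n) -> forall i : 'I_n, P i.
Proof. by move=> /allP allP i; apply: allP; rewrite mem_iota ltn_ord. Qed.

Lemma ord_has (P : pred nat) : has P (iota 0 n) -> exists i : 'I_n, P i.
Proof. by case/hasP=> i; rewrite mem_iota => lt_in Pi; exists (Ordinal lt_in). Qed.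

Lemma edge_graphE (i j : edge_graph n E) : adj i j = edgeb (val i) (val j).
Proof. by []. Qed.

(** Sending [i] to the [i]-th entry of [s] turns an induced copy into an equality of two Boolean
    adjacency tables; [x0] only serves as default for [nth]. *)
Lemma embeds_edge_graph (G : sgraph) (x0 : G) (s : seq G) :
  uniq s -> size s = n ->
  [seq [seq adj x y | y <- s] | x <- s] =
    [seq [seq edgeb i j | j <- iota 0 n] | i <- iota 0 n] ->
  embeds (edge_graph n E) G.
Proof.
move=> sU sn sE; exists (fun i : edge_graph n E => nth x0 s (val i)).
  move=> i j /eqP; rewrite nth_uniq // ?sn ?ltn_ord // => /eqP.
  exact: val_inj.
move=> i j; have [ltin ltjn] := (ltn_ord i, ltn_ord j).
have := congr1 (fun m => nth false (nth [::] m (val i)) (val j)) sE.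
rewrite !(nth_map x0) ?sn // !(nth_map 0) ?size_iota // !nth_iota //.
Qed.

End EdgeGraphs.

(** With [P] abstract, one disjunction serves for isomorphism, for induced copies and, as
    [P := eq H], for membership in the list. *)
Definition some_obstruction (P : sgraph -> Prop) : Prop :=
  P (path_graph 5) \/ P (cycle_graph 5) \/
  P F1 \/ P F2 \/ P F3 \/ P F4 \/ P F5 \/ P F6.

Definition nbh G (v : G) : {set G} := [set u | adj v u].

(** [s] lists the images of the vertices 0, 1, ... of the target graph. Identifying two of them
    would contradict the facts in the context, and the adjacency facts fill in the table. *)
Ltac find_copy x0 s :=
  match type of x0 with context [vertex ?G] =>
    let irr := fresh in have irr : forall x : G, adj x x = false by [exact: adj_irr];
    let sym := fresh in
    have sym : forall x y : G, adj x y = adj y x by [exact: adj_sym];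
    repeat match goal with
    | E : is_true (adj ?x ?y) |- _ => change (adj x y = true) in E
    end;
    apply: (@embeds_edge_graph _ _ _ x0 s) => //;
    [ rewrite /= !inE !negb_or; repeat (apply/andP; split) => //;
      apply/eqP=> ?; subst; congruence
    | rewrite /= !irr;
      repeat match goal with
      | E : adj ?x ?y = _ |- context [adj ?x ?y] => rewrite E
      | E : adj ?x ?y = _ |- context [adj ?y ?x] => rewrite [adj y x]sym E
      end; reflexivity ]
  end.

(** * Triangle-free graphs without obstructions, seen from a vertex of maximum degree *)

Section Structure.
Variable G : sgraph.
Implicit Types p q r s t u v w x y z : G.
Hypothesis tfG : triangle_free G.
Hypothesis freeG : ~ some_obstruction (fun H => embeds H G).

Lemma nbr_nonadj x y z : adj x y = true -> adj x z = true -> adj y z = false.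
Proof.
move=> xy xz; apply: contraNF (tfG x y z) => yz.
by rewrite xy xz yz.
Qed.

(** The other chords being excluded by triangle-freeness or by hypothesis, the pair [x0], [x4] alone
    decides between C5 and P5. *)
Lemma no_five_path x0 x1 x2 x3 x4 :
  adj x0 x1 = true -> adj x1 x2 = true -> adj x2 x3 = true -> adj x3 x4 = true ->
  adj x0 x3 = false -> adj x1 x4 = false -> False.
Proof.
move=> a01 a12 a23 a34 a03 a14; apply: freeG.
have a02 : adj x0 x2 = false by apply: (@nbr_nonadj x1); rewrite // 1?adj_sym.
have a13 : adj x1 x3 = false by apply: (@nbr_nonadj x2); rewrite // 1?adj_sym.
have a24 : adj x2 x4 = false by apply: (@nbr_nonadj x3); rewrite // 1?adj_sym.
case a04: (adj x0 x4); [right; left | left].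
  by find_copy x0 [:: x0; x1; x2; x3; x4].
by find_copy x0 [:: x0; x1; x2; x3; x4].
Qed.

Variable v : G.
Hypothesis max_v : forall u, #|nbh u| <= #|nbh v|.

(** A neighbour [s] of [v] not adjacent to [q] would give the path [p - q - r - v - s]. So [q] sees
    all of [nbh v] and also [p], against the maximality of [v]. *)
Lemma no_edge_at_distance2 p q r :
  adj v r = true -> adj r q = true -> adj q p = true ->
  adj v p = false -> adj v q = false -> False.
Proof.
move=> vr rq qp vp vq; suff: nbh v \proper nbh q.
  by move/proper_card; rewrite ltnNge max_v.
apply/properP; split; last by exists p; rewrite inE ?qp ?vp.
apply/subsetP => s; rewrite !inE => vs; apply: contraT => /negbTE qs.
have pr : adj p r = false by apply: (@nbr_nonadj q); rewrite // adj_sym.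
by case: (@no_five_path p q r v s); rewrite // 1?adj_sym.
Qed.

(** As [q] has the neighbours [v], [p], [r], maximality gives [v] two neighbours [s], [t] besides
    [q]; only the pairs between [s], [t] and [p], [r] remain undecided. *)
Lemma no_branching_at_distance2 q p r :
  adj v q = true -> adj q p = true -> adj q r = true -> p <> r ->
  p != v -> r != v -> adj v p = false -> adj v r = false -> False.
Proof.
move=> vq qp qr npr npv nrv vp vr.
have: 2 < #|nbh v|.
  apply: leq_trans (max_v q).
  have: [set v; p; r] \subset nbh q.
    by apply/subsetP => x; rewrite !inE => /orP[/orP[]|] /eqP-> //; rewrite adj_sym.
  move/subset_leq_card; apply: leq_trans; rewrite setUC cardsU1 !inE cards2.
  by rewrite negb_or nrv eq_sym (introF eqP npr) eq_sym npv.
rewrite (cardsD1 q) inE vq add1n ltnS => /card_gt1P[s [t []]].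
rewrite !inE => /andP[sq vs] /andP[tq vt] /eqP nst.
have qs := nbr_nonadj vq vs; have qt := nbr_nonadj vq vt.
have st := nbr_nonadj vs vt; have pr := nbr_nonadj qp qr.
move/eqP in sq; move/eqP in tq; move/eqP in npv; move/eqP in nrv.
(* Among the four possible edges, all four give [F6], three [F5], one [F3], none [F2]; two give [F4]
   if they share an end, and otherwise a path excluded by [no_five_path]. *)
case sp: (adj s p); case sr: (adj s r); case tp: (adj t p); case tr: (adj t r);
  try (by case: (@no_five_path p s v t r); rewrite // 1?adj_sym);
  try (by case: (@no_five_path r s v t p); rewrite // 1?adj_sym);
  apply: freeG; rewrite /some_obstruction.
- do 7 right. by find_copy v [:: v; p; r; q; s; t].
- do 6 right; left. by find_copy v [:: t; q; s; r; v; p].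
- do 6 right; left. by find_copy v [:: t; q; s; p; v; r].
- do 5 right; left. by find_copy v [:: q; s; v; p; r; t].
- do 6 right; left. by find_copy v [:: s; q; t; r; v; p].
- do 5 right; left. by find_copy v [:: v; p; q; s; t; r].
- do 4 right; left. by find_copy v [:: v; q; p; s; t; r].
- do 6 right; left. by find_copy v [:: s; q; t; p; v; r].
- do 5 right; left. by find_copy v [:: v; r; q; s; t; p].
- do 4 right; left. by find_copy v [:: v; q; r; s; t; p].
- do 5 right; left. by find_copy v [:: q; t; v; p; r; s].
- do 4 right; left. by find_copy v [:: v; q; p; t; s; r].
- do 4 right; left. by find_copy v [:: v; q; r; t; s; p].
- do 3 right; left. by find_copy v [:: v; q; s; t; p; r].
Qed.

(** By [no_edge_at_distance2], no neighbour of [v] sees [p], [q] or [r]. Since [q] has degree at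
    least two, so has [v], and two neighbours of [v] form with it a second P3, hence [F1]. *)
Lemma no_path_at_distance2 p q r :
  adj q p = true -> adj q r = true -> p <> r -> p <> v -> q <> v ->
  adj v p = false -> adj v q = false -> False.
Proof.
move=> qp qr npr npv nqv vp vq.
have far w : adj v w = true -> adj w q = false /\ adj w p = false.
  move=> vw; split; apply/negP=> e.
    by case: (@no_edge_at_distance2 p q w).
  by case: (@no_edge_at_distance2 q p w); rewrite // adj_sym.
case vr: (adj v r); first by have [] := far r vr; rewrite adj_sym qr.
have nrv : r <> v by move=> rv; rewrite -rv adj_sym qr in vq.
have farr w : adj v w = true -> adj w r = false.
  move=> vw; apply/negP=> e.
  by case: (@no_edge_at_distance2 q r w); rewrite // adj_sym.
have: 1 < #|nbh v|.
  apply: leq_trans (max_v q); apply/card_gt1P.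
  by exists p, r; rewrite !inE; split=> //; apply/eqP.
case/card_gt1P=> s [t []]; rewrite !inE => vs vt /eqP nst.
have [sq sp] := far s vs; have [tq tp] := far t vt.
have sr := farr s vs; have tr := farr t vt.
have st := nbr_nonadj vs vt; have pr := nbr_nonadj qp qr.
apply: freeG; do 2 right; left.
by find_copy v [:: s; v; t; p; q; r].
Qed.

(** If [u'] escaped [y], some P3 would have two vertices outside N[v]: [u' - u - y] when [u] and
    [u'] are adjacent, and [u - x - u'] otherwise, which is a branching if [x] is a neighbour of
    [v]. *)
Lemma equal_blocks x y u u' : u \in ~: cl_nbh v -> u' \in ~: cl_nbh v ->
  u \in cl_nbh x -> u \in cl_nbh y -> u' \in cl_nbh x -> u' \in cl_nbh y.
Proof.
rewrite !inE !negb_or => /andP[nuv /negbTE vu] /andP[nu'v /negbTE vu'] xu yu xu'.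
have [/eqP ? ?] := (nuv, nu'v).
apply: contraT; rewrite negb_or => /andP[/eqP nu'y /negbTE yu'].
case uu': (adj u u').
  have {}yu : adj u y = true.
    by case/predU1P: yu => [E|]; [rewrite E yu' in uu' | rewrite adj_sym].
  by case: (@no_path_at_distance2 u' u y) => //; apply/eqP.
have nuu' : u <> u' by move=> E; case: nu'y; rewrite E yu' orbF in yu; apply/eqP.
have {}xu : adj x u = true.
  by case/predU1P: xu => // E; rewrite -E uu' orbF eq_sym in xu'; case: nuu'; apply/eqP.
have {}xu' : adj x u' = true.
  by case/predU1P: xu' => // E; rewrite -E adj_sym uu' in xu.
case vx: (adj v x); first by case: (@no_branching_at_distance2 x u u').
case: (@no_path_at_distance2 u x u') => // [] xv.
by rewrite xv vu in xu.
Qed.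

(* If every vertex of [T] were needed, [T] would pick one vertex per block, and
   two of them would dominate [v] and another neighbour of [v]; this yields a
   path [u - s - v - w - u'] that is forbidden as an induced P5 or C5. *)
Lemma superfluous_vertex T : dominating T ->
  exists2 t, t \in T & ~: cl_nbh v \subset dominated (T :\ t).
Proof.
move=> /eqP domT.
have domx x : exists2 s, s \in T & x \in cl_nbh s.
  by apply/bigcupP; rewrite -/(dominated T) domT.
case: (boolP [exists t, (t \in T) && (~: cl_nbh v \subset dominated (T :\ t))]).
  by case/existsP=> t /andP[]; exists t.
move/existsPn=> need; exfalso.
have private s : s \in T -> exists u, [/\ u \in ~: cl_nbh v, u \in cl_nbh s &
    forall s', s' \in T -> u \in cl_nbh s' -> s' = s].
  move=> sT; have:= need s; rewrite sT => /subsetPn[u uU uT].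
  have only s' : s' \in T -> u \in cl_nbh s' -> s' = s.
    move=> s'T us'; apply/eqP; apply: contraNT uT => ss'.
    by apply/bigcupP; exists s'; rewrite // !inE ss'.
  have [s' s'T us'] := domx u.
  by exists u; split=> //; rewrite -(only s').
have vT : v \notin T.
  by apply/negP=> /private[u []]; rewrite inE => /negP.
have [s sT] := domx v; have [u [uU us usT]] := private s sT.
rewrite cl_nbhE => /predU1P[vs|sv]; first by rewrite vs sT in vT.
have nuv := uU; rewrite !inE negb_or in nuv; case/andP: nuv => /eqP nuv /negbTE vu.
have {}us : adj s u = true.
  by move: us; rewrite cl_nbhE => /predU1P[E|//]; rewrite E adj_sym sv in vu.
have: 1 < #|nbh v|.
  apply: leq_trans (max_v s); apply/card_gt1P.
  by exists v, u; rewrite !inE; split=> //; apply/eqP=> /esym.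
rewrite (cardsD1 s) inE adj_sym sv add1n ltnS => /card_gt0P[w].
rewrite !inE => /andP[nws vw]; rewrite adj_sym in sv.
have sw : adj s w = false := nbr_nonadj sv vw.
have [s' s'T ws'] := domx w; have [u' [u'U us' us'T]] := private s' s'T.
have ns's : s' <> s.
  by move=> E; move: ws'; rewrite E cl_nbhE (negbTE nws) sw.
(* If [s'] is not [w] itself, it is a neighbour of [w] outside N[v], and [equal_blocks] at [s']
   shows that [w] and [s'] dominate the same vertices outside N[v]. *)
have [u'w uw] : u' \in cl_nbh w /\ u \notin cl_nbh w.
  move: ws'; rewrite cl_nbhE => /predU1P[->|s'w].
    by split=> //; apply/negP=> /(usT _ s'T).
  have s'U : s' \in ~: cl_nbh v.
    rewrite inE cl_nbhE negb_or (contraNneq _ vT) => [|<- //].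
    by rewrite (nbr_nonadj (x := w)) // adj_sym.
  have ws' : s' \in cl_nbh w by rewrite cl_nbhE adj_sym s'w orbT.
  have s's' := cl_nbh_refl s'.
  split; first exact: (equal_blocks s'U u'U s's').
  by apply/negP=> uw; apply/ns's/usT => //; apply: (equal_blocks s'U uU ws').
have wu' : adj w u' = true.
  by move: u'w; rewrite cl_nbhE => /predU1P[E|//]; rewrite E !inE vw orbT in u'U.
have wu : adj w u = false.
  by apply: contraNF uw; rewrite cl_nbhE => ->; rewrite orbT.
have su' : adj s u' = false.
  by apply/negP=> su'; apply/ns's/esym/us'T; rewrite // cl_nbhE su' orbT.
by case: (@no_five_path u s v w u'); rewrite // 1?adj_sym.
Qed.

End Structure.

Lemma obstruction_free_game G : 0 < #|G| -> triangle_free G ->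
  ~ some_obstruction (fun H => embeds H G) ->
  game_domination_number G = domination_number G.
Proof.
move=> /card_gt0P[v0 _] tfG freeG; apply/eqP.
rewrite eqn_leq domination_number_le_game andbT.
have [v _ max_v] := @arg_maxnP G v0 predT (fun v => #|nbh v|) isT.
have {}max_v (u : G) : #|nbh u| <= #|nbh v| by have := max_v u isT.
have [T domT <-] := domination_number_attained G.
have [t tT UT] := superfluous_vertex tfG freeG max_v domT.
rewrite (cardsD1 t T) tT.
apply: game_domination_number_blocks UT => x y u u'.
exact: (equal_blocks tfG freeG max_v).
Qed.

(** * Computations on the eight graphs *)

Definition edge_graph_gap n E : bool :=
  let nb i j := (j == i) || edgeb E i j in
  let V := iota 0 n in
  has (fun a => has (fun b => all (fun x => nb a x || nb b x) V) V) V &&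
  all (fun v => has (fun u => has (fun w => has (fun z =>
    [&& nb u w, ~~ nb v w, ~~ nb u z & ~~ nb v z]) V) V) V) V.

Lemma edge_graph_two_move_gap n E :
  edge_graph_gap n E -> two_move_gap (edge_graph n E).
Proof.
case/andP=> /ord_has[a /ord_has[b /ord_all dom]] /ord_all reply; split.
  by exists a, b => x; rewrite !cl_nbhE !edge_graphE; apply: dom.
move=> v; have /ord_has[u /ord_has[w /ord_has[z gap]]] := reply v.
by exists u, w, z; rewrite !cl_nbhE !edge_graphE.
Qed.

Lemma edge_graph_triangle_free n E :
  all (fun i => all (fun j => all (fun k =>
    ~~ [&& edgeb E i j, edgeb E j k & edgeb E i k])
    (iota 0 n)) (iota 0 n)) (iota 0 n) ->
  triangle_free (edge_graph n E).
Proof.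
by move=> /ord_all tf x y z; have /ord_all/(_ y)/ord_all/(_ z) := tf x.
Qed.

(** In a triangle-free graph these vertices induce a P5 or a C5; this separates the obstructions on
    five vertices from those on six. *)
Definition five_path G : Prop := exists x0 x1 x2 x3 x4 : G,
  [&& adj x0 x1, adj x1 x2, adj x2 x3, adj x3 x4, ~~ adj x0 x3 & ~~ adj x1 x4].

Lemma embeds_five_path H G : embeds H G -> five_path H -> five_path G.
Proof.
case=> f _ fM [x0 [x1 [x2 [x3 [x4 h]]]]].
by exists (f x0), (f x1), (f x2), (f x3), (f x4); rewrite !fM.
Qed.

Lemma edge_graph5_five_path E :
  [&& edgeb E 0 1, edgeb E 1 2, edgeb E 2 3, edgeb E 3 4,
      ~~ edgeb E 0 3 & ~~ edgeb E 1 4] ->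
  five_path (edge_graph 5 E).
Proof.
move=> h; exists (@Ordinal 5 0 isT), (@Ordinal 5 1 isT), (@Ordinal 5 2 isT).
by exists (@Ordinal 5 3 isT), (@Ordinal 5 4 isT).
Qed.

Lemma edge_graph_no_five_path n E :
  (let V := iota 0 n in
   all (fun x0 => all (fun x1 => edgeb E x0 x1 ==> all (fun x2 => edgeb E x1 x2 ==>
   all (fun x3 => [&& edgeb E x2 x3 & ~~ edgeb E x0 x3] ==>
   all (fun x4 => edgeb E x3 x4 ==> edgeb E x1 x4) V) V) V) V) V) ->
  ~ five_path (edge_graph n E).
Proof.
move=> /ord_all noP [x0 [x1 [x2 [x3 [x4]]]]]; rewrite !edge_graphE.
case/and5P=> a01 a12 a23 a34 /andP[a03 /negP]; apply.
have /ord_all/(_ x1)/implyP/(_ a01)/ord_all/(_ x2)/implyP/(_ a12) := noP x0.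
move=> /ord_all/(_ x3); rewrite a23 a03 => /ord_all/(_ x4).
by rewrite a34.
Qed.

Lemma some_obstructionP P :
  some_obstruction P <-> exists2 H, some_obstruction (eq H) & P H.
Proof.
rewrite /some_obstruction; split=> [|[H obs PH]].
  by case=> [|[|[|[|[|[|[|]]]]]]] PH; (eexists; last exact: PH); tauto.
by case: obs => [|[|[|[|[|[|[|]]]]]]] <-; tauto.
Qed.

(** The last component ensures that no obstruction is a proper induced subgraph of another. *)
Lemma obstruction_properties H : some_obstruction (eq H) ->
  [/\ two_move_gap H, triangle_free H &
      #|H| = 5 /\ five_path H \/ #|H| = 6 /\ ~ five_path H].
Proof.
move=> obs; have {obs} [n [E [-> gap tf size_path]]]: exists n E,
    [/\ H = edge_graph n E, edge_graph_gap n E,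
      all (fun i => all (fun j => all (fun k =>
        ~~ [&& edgeb E i j, edgeb E j k & edgeb E i k])
        (iota 0 n)) (iota 0 n)) (iota 0 n) &
      n = 5 /\ five_path (edge_graph n E) \/ n = 6 /\ ~ five_path (edge_graph n E)].
  by case: obs => [|[|[|[|[|[|[|]]]]]]] ->; do 2 eexists;
    (split; [reflexivity | by vm_compute | by vm_compute |
      first [left; split; [reflexivity | exact: edge_graph5_five_path]
            |right; split;
              [reflexivity | apply: edge_graph_no_five_path; vm_compute]]]).
split; [exact: edge_graph_two_move_gap | exact: edge_graph_triangle_free |].
by rewrite card_ord.
Qed.

(** * Deciding isomorphism, and the two directions of the characterization *)

Lemma induced_neq0 G (A : {set G}) : A != set0 -> 0 < #|induced A|.
Proof. by rewrite -card_gt0 card_sig. Qed.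

(** A finite search decides isomorphism, so cases on it need no classical axiom; the bound on the
    orders makes the injection bijective. *)
Lemma isomorphicP G H : reflect (isomorphic G H)
  [exists f : {ffun G -> H}, [&& #|H| <= #|G|, injectiveb f &
    [forall x, forall y, adj (f x) (f y) == adj x y]]].
Proof.
apply: (iffP existsP) => [[f /and3P[leHG /injectiveP fI /forallP fM]]|[f fB fM]].
  exists f; first exact: (inj_card_bij fI leHG).
  by move=> x y; apply/eqP; have /forallP := fM x; apply.
exists [ffun x => f x]; apply/and3P; split; first by rewrite (bij_eq_card fB).
  by apply/injectiveP=> x y; rewrite !ffunE; apply: bij_inj.
by apply/forallP=> x; apply/forallP=> y; rewrite !ffunE fM.
Qed.

Theorem theorem4p6 (G : sgraph) (hG : 0 < #|G|) :
  (triangle_free G /\ minimally_gg_imperfect G) <->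
  (isomorphic G (path_graph 5) \/ isomorphic G (cycle_graph 5) \/
   isomorphic G F1 \/ isomorphic G F2 \/ isomorphic G F3 \/
   isomorphic G F4 \/ isomorphic G F5 \/ isomorphic G F6).
Proof.
rewrite -/(some_obstruction (isomorphic G)); split.
  case=> tfG [minG impG].
  have [//|noniso] : some_obstruction (isomorphic G) \/ ~ some_obstruction (isomorphic G).
    rewrite /some_obstruction.
    have dec H : isomorphic G H \/ ~ isomorphic G H by case: (isomorphicP G H); tauto.
    move: (dec (path_graph 5)) (dec (cycle_graph 5)) (dec F1) (dec F2) (dec F3).
    by move: (dec F4) (dec F5) (dec F6); tauto.
  suff E : game_domination_number G = domination_number G.
    by rewrite E ltnn in impG.
  apply: obstruction_free_game => // /some_obstructionP[H obsH [f fI fM]].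
  have [gapH _ cardH] := obstruction_properties obsH.
  have H0 : 0 < #|H| by case: cardH => -[->].
  pose A := f @: [set: H].
  have A0 : A != set0 by rewrite -card_gt0 card_imset // cardsT.
  have isoA : isomorphic H (induced A) by apply: isomorphic_image.
  (* If the copy of [H] spans [G], then [G] is isomorphic to [H]. Otherwise [induced A] is perfect
     by minimality, yet imperfect as a copy of [H]. *)
  have [AT|AT] := eqVneq A setT.
    apply/noniso/some_obstructionP; exists H => //; apply: isomorphic_sym.
    by apply: isomorphic_trans isoA _; rewrite AT;
      apply/isomorphic_sym/isomorphic_induced_setT.
  have properA : A \proper [set: G] by rewrite properEneq AT subsetT.
  (* Perfection of [induced A] is used at its full vertex set, whence the passage to the subgraph
     induced by [setT]. *)
  have TA0 : [set: induced A] != set0 by rewrite -card_gt0 cardsT induced_neq0.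
  have isoT := isomorphic_trans isoA (isomorphic_induced_setT (induced A)).
  have := two_move_gap_imperfect (induced_neq0 TA0) (isomorphic_two_move_gap isoT gapH).
  by rewrite (minG A A0 properA) // ltnn.
case/some_obstructionP=> H obsH isoGH.
have [gapH tfH cardH] := obstruction_properties obsH.
have GH := isomorphic_embeds isoGH.
have tfG := embeds_triangle_free GH tfH.
split=> //; split; last first.
  exact: two_move_gap_imperfect (isomorphic_two_move_gap (isomorphic_sym isoGH) gapH).
move=> A A0 properA B B0; set K := induced B.
have KA : embeds K (induced A) by apply: embeds_induced.
have KH : embeds K H.
  by apply: embeds_trans KA _; apply: embeds_trans (embeds_induced A) GH.
have ltKH : #|K| < #|H|.
  apply: leq_ltn_trans (embeds_card KA) _; rewrite card_sig.
  apply: leq_trans (embeds_card GH).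
  by have := proper_card properA; rewrite cardsT.
apply: obstruction_free_game; first exact: induced_neq0.
  exact: embeds_triangle_free KH tfH.
(* [L] has fewer vertices than [H], so it has five and [H] six; the five-vertex path in [L] would
   then carry over to [H], which has none. *)
case/some_obstructionP=> L obsL LK.
have ltLH := leq_ltn_trans (embeds_card LK) ltKH.
have [_ _ cardL] := obstruction_properties obsL.
case: cardL ltLH => -[-> pathL]; case: cardH => -[-> pathH] // _.
exact/pathH/(embeds_five_path (embeds_trans LK KH)).
Qed.
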